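(* Let $\Bbbk$ be a field of characteristic $0$ and let $I$ be a nonempty finite set. The image of the left bracketing operator on $\mathbf{L}[I]$ is $\mathbf{Lie}[I]$. In addition, $\mathbf{Lie}[I]$ is the eigenspace of eigenvalue $|I|$ of this operator.
   Context: For a finite set $I$, $\mathbf{L}[I]$ is the $\Bbbk$-vector space with basis $\mathtt{H}_\ell$ indexed by the linear orders $\ell$ on $I$, written as lists $\ell=i_1i_2\cdots i_n$ of the elements of $I$. For $I=S\sqcup T$ (disjoint, possibly empty subsets with union $I$), define $\mu_{S,T}(\mathtt{H}_{\ell_1}\otimes\mathtt{H}_{\ell_2})=\mathtt{H}_{\ell_1\cdot\ell_2}$ (concatenation of lists) and $\Delta_{S,T}:\mathbf{L}[I]\to\mathbf{L}[S]\otimes\mathbf{L}[T]$, $\Delta_{S,T}(\mathtt{H}_\ell)=\mathtt{H}_{\ell|_S}\otimes\mathtt{H}_{\ell|_T}$ (restriction of linear orders). For $I\neq\emptyset$, $$\mathbf{Lie}[I]=\mathcal{P}(\mathbf{L})[I]=\bigcap_{I=S\sqcup T,\ S,T\neq\emptyset}\ker\bigl(\Delta_{S,T}:\mathbf{L}[I]\to\mathbf{L}[S]\otimes\mathbf{L}[T]\bigr).$$ The commutator bracket of $x\in\mathbf{L}[S]$ and $y\in\mathbf{L}[T]$ is $[x,y]=\mu_{S,T}(x\otimes y)-\mu_{T,S}(y\otimes x)\in\mathbf{L}[S\sqcup T]$. Write $\mathtt{H}_{i}\in\mathbf{L}[\{i\}]$ for the basis element of the unique order on $\{i\}$. The left bracketing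 operator on $\mathbf{L}[I]$ is the linear map $$\mathtt{H}_{i_1i_2\cdots i_n}\mapsto[\dots[[\mathtt{H}_{i_1},\mathtt{H}_{i_2}],\mathtt{H}_{i_3}],\dots,\mathtt{H}_{i_n}]$$ (the identity when $n=1$). *)

(* Defs.v *)
From HB Require Import structures.
From mathcomp Require Import all_boot all_order all_algebra.

Set Implicit Arguments.
Unset Strict Implicit.
Unset Printing Implicit Defensive.

Import GRing.Theory.
Local Open Scope ring_scope.

Section FreeSpace.
Variables (k : fieldType) (A : finType).

(* The k-vector space with basis A: delta a is the basis element a. *)
Local Notation free_space := {ffun A -> k^o}.

Definition delta (a : A) : free_space := [ffun b => (b == a)%:R].

Definition extend_fun (V : vectType k) (f : A -> V) (x : free_space) : V :=
  \sum_a x a *: f a.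

Fact extend_fun_is_linear (V : vectType k) (f : A -> V) :
  linear (extend_fun f).
Proof.
move=> c x y; rewrite /extend_fun scaler_sumr -big_split /=.
by apply: eq_bigr => a _; rewrite !ffunE scalerDl scalerA.
Qed.
HB.instance Definition _ (V : vectType k) (f : A -> V) :=
  GRing.isLinear.Build k free_space V _ (extend_fun f)
    (extend_fun_is_linear f).

Definition extend (V : vectType k) (f : A -> V) : 'Hom(free_space, V) :=
  linfun (extend_fun f).

Lemma extend_delta (V : vectType k) (f : A -> V) a : extend f (delta a) = f a.
Proof.
rewrite lfunE /= /extend_fun (bigD1 a) //= ffunE eqxx scale1r big1 ?addr0 //.
by move=> b /negPf ba; rewrite ffunE ba scale0r.
Qed.

End FreeSpace.

Section LinearOrders.
Variable U : finType.
Implicit Types (S T I : {set U}) (s t : seq U).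

(* A linear order on S is a list in which each element of S occurs exactly
   once; see mem_permutations_enum. *)
Definition linord S : finType := seq_sub (permutations (enum S)).

Lemma mem_permutations_enum S s :
  (s \in permutations (enum S)) = uniq s && ([set:: s] == S).
Proof.
rewrite mem_permutations; apply/idP/andP => [sS|[us /eqP <-]].
  rewrite (perm_uniq sS) enum_uniq; split=> //.
  by apply/eqP/setP => i; rewrite inE (perm_mem sS) mem_enum.
by apply: uniq_perm; rewrite ?enum_uniq // => i; rewrite mem_enum inE.
Qed.

Definition restrict S s : seq U := [seq i <- s | i \in S].

Lemma restrict_linord I S s : S \subset I ->
  s \in permutations (enum I) -> restrict S s \in permutations (enum S).
Proof.
rewrite !mem_permutations_enum => /subsetP SI /andP[us /eqP sI].
rewrite filter_uniq //=; apply/eqP/setP => i; rewrite inE mem_filter.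
by have [/SI|//] := boolP (i \in S); rewrite -sI inE.
Qed.

Definition decomposition I S T : bool :=
  (S :|: T == I) && [disjoint S & T].

Lemma cat_linord I S T s t : decomposition I S T ->
  s \in permutations (enum S) -> t \in permutations (enum T) ->
  s ++ t \in permutations (enum I).
Proof.
rewrite !mem_permutations_enum => /andP[/eqP <- dST].
move=> /andP[us /eqP sS] /andP[ut /eqP tT]; rewrite cat_uniq us ut andbT /=.
apply/andP; split; last first.
  by apply/eqP/setP => i; rewrite -sS -tT !inE mem_cat.
apply/hasPn => i it; apply: contraTN it => si.
have iS : i \in S by rewrite -sS inE.
by have := disjointFr dST iS; rewrite -tT inE => ->.
Qed.

End LinearOrders.

Section SpeciesL.
Variables (k : fieldType) (U : finType).
Implicit Types (S T I : {set U}) (s t : seq U).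

Definition L S : vectType k := {ffun linord S -> k^o}.

(* The basis element H_s of L[S]; by convention it is 0 when the list s is
   not a linear order on S. *)
Definition H S s : L S :=
  if insub s is Some l then delta k (l : linord S) else 0.

Lemma H_val S (l : linord S) : H S (val l) = delta k l.
Proof. by rewrite /H valK. Qed.

(* L[S] (x) L[T], presented by its basis of pairs (l1, l2), which stand for
   H_l1 (x) H_l2. *)
Definition LL S T : vectType k := {ffun linord S * linord T -> k^o}.

Definition tens S T (x : L S) (y : L T) : LL S T :=
  [ffun p => (x : {ffun linord S -> k^o}) p.1 *
             (y : {ffun linord T -> k^o}) p.2].

Lemma tens_delta S T (l1 : linord S) (l2 : linord T) :
  tens (delta k l1 : L S) (delta k l2 : L T) = delta k (l1, l2).
Proof. by apply/ffunP => -[a b]; rewrite !ffunE /= -natrM mulnb. Qed.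

(* The maps mu_{S,T} and Delta_{S,T}, meaningful when I is the disjoint union
   of S and T (by cat_linord and restrict_linord all the lists below are then
   linear orders on the relevant sets). Stating them for arbitrary I, S, T
   avoids transporting along set equalities. *)
Definition mu I S T : 'Hom(LL S T, L I) :=
  extend (fun p : linord S * linord T => H I (val p.1 ++ val p.2)).

Definition Delta I S T : 'Hom(L I, LL S T) :=
  extend (fun l : linord I =>
    tens (H S (restrict S (val l))) (H T (restrict T (val l)))).

Definition Lie I : {vspace L I} :=
  (\bigcap_(ST : {set U} * {set U} |
      [&& decomposition I ST.1 ST.2, ST.1 != set0 & ST.2 != set0])
     lker (Delta I ST.1 ST.2))%VS.

Lemma mu_H I S T (l1 : linord S) (l2 : linord T) :
  mu I S T (tens (H S (val l1)) (H T (val l2))) = H I (val l1 ++ val l2).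
Proof. by rewrite !H_val tens_delta /mu extend_delta. Qed.

Lemma Delta_H I S T (l : linord I) :
  Delta I S T (H I (val l)) =
    tens (H S (restrict S (val l))) (H T (restrict T (val l))).
Proof. by rewrite H_val /Delta extend_delta. Qed.

Definition bracket I S T (x : L S) (y : L T) : L I :=
  mu I S T (tens x y) - mu I T S (tens y x).

(* [...[[H_i1, H_i2], H_i3], ..., H_in] in L[S], where the list is given in
   reverse order i_n ... i_1 and S = {i_1, ..., i_n}. The value 0 on the empty
   list is a dummy. *)
Fixpoint lbracket_rev s S : L S :=
  match s with
  | [::] => 0
  | [:: i] => H S [:: i]
  | i :: t => bracket S (lbracket_rev t (S :\ i)) (H [set i] [:: i])
  end.

Definition left_bracketing I : 'End(L I) :=
  extend (fun l : linord I => lbracket_rev (rev (val l)) I).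

Lemma left_bracketing_H I (l : linord I) :
  left_bracketing I (H I (val l)) = lbracket_rev (rev (val l)) I.
Proof. by rewrite H_val /left_bracketing extend_delta. Qed.

End SpeciesL.

(* Main.v *)
(** Brackets of primitive elements are primitive, so the image of the left
    bracketing operator lies in Lie[I].  Conversely, left bracketing is the
    convolution of the antipode with the degree operator:
    [H_l |-> \sum_(I = S + T) (-1)^|T| |S| H_(rev(l|T) . l|S)].  On a primitive
    element only the term [S = I] survives, so the operator is multiplication
    by [|I|] on Lie[I]; in characteristic 0 both claims follow. *)
Require Import Defs.
From mathcomp Require Import all_boot all_order all_algebra.
Local Open Scope ring_scope.

Set Implicit Arguments.
Unset Strict Implicit.
Unset Printing Implicit Defensive.

Import GRing.Theory.

(** * Nested commutators as signed sums of words *)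

Section NestedCommutators.
Variable U : finType.
Implicit Types (S T I : {set U}) (s t w : seq U).

(* The image under the linear extension of [F] of the signed sum of words
   obtained by expanding [...[[i_1, i_2], i_3], ..., i_n], where
   [s = i_n ... i_1] as in [lbracket_rev]. *)
Fixpoint nested (V : zmodType) s (F : seq U -> V) : V :=
  match s with
  | [::] => 0
  | [:: i] => F [:: i]
  | i :: t => nested t (fun w => F (w ++ [:: i]) - F (i :: w))
  end.

Lemma nestedS (V : zmodType) i t (F : seq U -> V) : t != [::] ->
  nested (i :: t) F = nested t (fun w => F (w ++ [:: i]) - F (i :: w)).
Proof. by case: t. Qed.

(** Only rearrangements of [s] occur in the expansion. This later lets identities valid only on
    linear orders be applied under [nested]. *)
Lemma eq_nested (V : zmodType) s (F G : seq U -> V) :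
  (forall w, perm_eq w s -> F w = G w) -> nested s F = nested s G.
Proof.
elim: s F G => // i [|j t] IH F G FG; first exact: FG.
rewrite !(nestedS i) //; apply: IH => w wt.
by congr (_ - _); apply: FG; rewrite ?perm_cons // perm_catC perm_cons.
Qed.

Lemma nested0 (V : zmodType) s : nested s (fun=> 0 : V) = 0.
Proof.
elim: s => // i [|j t] IH //; rewrite nestedS // -[RHS]IH.
by apply: eq_nested => w _; rewrite subr0.
Qed.

Lemma morph_nested (V W : zmodType) (f : V -> W) s F :
  {morph f : x y / x - y} -> f (nested s F) = nested s (f \o F).
Proof.
move=> fB; elim: s F => [|i [|j t] IH] F //.
  (* Writing 0 as 0 - 0 shows that a map preserving differences fixes 0. *)
  by rewrite /= -[in LHS](subrr 0) fB subrr.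
rewrite !(nestedS i) // IH.
by apply: eq_nested => w _ /=; rewrite fB.
Qed.

Lemma restrict_nil S s : ~~ has (mem S) s -> restrict S s = [::].
Proof. by rewrite has_filter negbK => /eqP. Qed.

Lemma restrict_id S s : {subset s <= S} -> restrict S s = s.
Proof. by move=> /allP sS; apply/all_filterP. Qed.

(** Bracketing with a letter [i] of [S] changes only the first argument of [F], so the induction
    hypothesis applies to a modified [F] while [t] meets [S]. Once it does not, [w ++ [:: i]] and
    [i :: w] have the same restrictions and their terms cancel. The case of [T] is symmetric. *)
Lemma nested_primitive (V : zmodType) S T s (F : seq U -> seq U -> V) :
    [disjoint S & T] -> {subset s <= S :|: T} ->
    has (mem S) s -> has (mem T) s ->
  nested s (fun w => F (restrict S w) (restrict T w)) = 0.
Proof.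
move=> dST; elim: s F => // i t IH F sST hS hT.
have tN0 : t != [::].
  apply: contraTneq hT => t0; move: hS; rewrite t0 /= !orbF => iS.
  by rewrite (disjointFr dST iS).
have tST : {subset t <= S :|: T}.
  by move=> j jt; apply: sST; rewrite inE jt orbT.
have rnil (R : {set U}) w :
    perm_eq w t -> ~~ has (mem R) t -> restrict R w = [::].
  by move=> wt nR; rewrite restrict_nil // (perm_has _ wt).
rewrite nestedS //.
have /setUP[iS|iT] := sST _ (mem_head i t).
  have iT := disjointFr dST iS; move: hT; rewrite /= iT /= => hT.
  have [hSt|nSt] := boolP (has (mem S) t).
    rewrite -[RHS](IH (fun a b => F (a ++ [:: i]) b - F (i :: a) b)) //.
    by apply: eq_nested => w _; rewrite /restrict !filter_cat /= iS iT cats0.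
  rewrite -[RHS](nested0 _ t); apply: eq_nested => w wt.
  have := rnil S w wt nSt; rewrite /restrict !filter_cat /= iS iT cats0.
  by move=> ->; rewrite subrr.
have iS := disjointFl dST iT; move: hS; rewrite /= iS /= => hS.
have [hTt|nTt] := boolP (has (mem T) t).
  rewrite -[RHS](IH (fun a b => F a (b ++ [:: i]) - F a (i :: b))) //.
  by apply: eq_nested => w _; rewrite /restrict !filter_cat /= iS iT cats0.
rewrite -[RHS](nested0 _ t); apply: eq_nested => w wt.
have := rnil T w wt nTt; rewrite /restrict !filter_cat /= iS iT cats0.
by move=> ->; rewrite subrr.
Qed.

(** * Convolution of the antipode with functions of the degree *)

Section Convolution.
Variables (k : fieldType) (V : lmodType k).
Implicit Types (G : nat -> seq U -> V) (F : seq U -> V).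

(** Since [s] is the reverse of an order l, this is rev(l|T) . l|S, with T the complement of S. *)
Definition antipode_word S s := restrict (~: S) s ++ rev (restrict S s).

(** The degree is an argument of [G] so that the identity and the degree operator can both be
    convolved with the antipode. *)
Definition antipode_conv s G : V :=
  \sum_(S : {set U} | S \subset [set:: s])
    (-1) ^+ #|[set:: s] :\: S| *: G #|S| (antipode_word S s).

Lemma antipode_conv_nil G : antipode_conv [::] G = G 0 [::].
Proof.
rewrite /antipode_conv (big_pred1 set0) => [|S].
  by rewrite set_nil setD0 cards0 scale1r.
by rewrite set_nil subset0.
Qed.

(** The subsets are split by membership of [i]: inside [S] it lands at the end of the word and
    raises the degree; outside, it lands in front and flips the sign. *)
Lemma antipode_conv_cons i t G : i \notin t ->
  antipode_conv (i :: t) G =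
    antipode_conv t (fun j w => G j.+1 (w ++ [:: i]) - G j (i :: w)).
Proof.
move=> it; rewrite /antipode_conv set_cons.
set J := [set:: t]; have iJ : i \notin J by rewrite inE.
rewrite (bigID (fun S => i \in S)) /=.
under [RHS]eq_bigr do rewrite scalerBr.
rewrite big_split /=; congr (_ + _).
  rewrite (reindex_onto (fun S => i |: S) (fun S => S :\ i)) /=; last first.
    by move=> S /andP[_ iS]; rewrite setD1K.
  apply: eq_big => [S|S /andP[/andP[SJ _] /eqP SE]].
    rewrite setU11 andbT; apply/andP/idP => [[SJ /eqP SE]|SJ].
      by rewrite -SE -(setU1K iJ) setSD.
    have iS : i \notin S by apply: contra iJ; apply: subsetP.
    by rewrite setUS // setU1K.
  have iS : i \notin S by rewrite -SE !inE eqxx.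
  rewrite cardsU1 iS; congr ((-1) ^+ _ *: G _ _).
    apply: eq_card => j; rewrite !inE.
    by have [->|] := eqVneq j i; rewrite //= (negPf it) andbF.
  rewrite /antipode_word /restrict /= !inE eqxx /= rev_cons -cats1 -[RHS]catA.
  congr (_ ++ rev _ ++ _); apply: eq_in_filter => j jt; rewrite !inE;
  by have [ji|] := eqVneq j i => //; rewrite -ji jt in it.
apply: eq_big => [S|S /andP[SJ iS]].
  apply/andP/idP => [[/subsetP SJ iS]|SJ].
    apply/subsetP => j jS; have /setU1P[ji|//] := SJ j jS.
    by rewrite -ji jS in iS.
  split; first exact: subset_trans SJ (subsetUr _ _).
  by apply: contra iJ; apply: subsetP.
have -> : (i |: J) :\: S = i |: (J :\: S).
  by apply/setP => j; rewrite !inE; case: eqVneq => [->|] //=; rewrite iS.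
rewrite cardsU1 !inE (negPf it) andbF exprS mulN1r scaleNr.
by rewrite /antipode_word /restrict /= !inE iS (negPf iS).
Qed.

Lemma eq_antipode_conv s G1 G2 : (forall j w, G1 j w = G2 j w) ->
  antipode_conv s G1 = antipode_conv s G2.
Proof. by move=> eG; apply: eq_bigr => S _; rewrite eG. Qed.

Lemma antipode_convD s G1 G2 :
  antipode_conv s (fun j w => G1 j w + G2 j w) =
    antipode_conv s G1 + antipode_conv s G2.
Proof. by rewrite -big_split; apply: eq_bigr => S _; rewrite scalerDr. Qed.

(** The defining property of the antipode. The recursion keeps [G] independent of the degree and
    ends with two equal terms on a one-letter word. *)
Lemma antipode_conv_id s F : uniq s -> s != [::] ->
  antipode_conv s (fun=> F) = 0.
Proof.
elim: s F => // i [|j t] IH F /andP[it ut] _; rewrite antipode_conv_cons //.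
  by rewrite antipode_conv_nil subrr.
by rewrite (IH (fun w => F (w ++ [:: i]) - F (i :: w))).
Qed.

(** The recursion produces (n+1) F(wi) - n F(iw) = F(wi) + n (F(wi) - F(iw)). The first summand dies
    by [antipode_conv_id]; the second is the recursion of [nested]. *)
Lemma antipode_conv_degree s F : uniq s -> s != [::] ->
  antipode_conv s (fun n w => F w *+ n) = nested s F.
Proof.
elim: s F => // i t IH F /andP[it ut] _; rewrite antipode_conv_cons //.
have [->|tN0] := eqVneq t [::].
  by rewrite antipode_conv_nil mulr1n mulr0n subr0.
rewrite nestedS // -IH //.
rewrite (@eq_antipode_conv _ _ (fun n w => F (w ++ [:: i]) +
    (F (w ++ [:: i]) - F (i :: w)) *+ n)); last first.
  by move=> n w; rewrite mulrS mulrnBl addrA.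
rewrite antipode_convD (antipode_conv_id (fun w => F (w ++ [:: i]))) //.
by rewrite add0r.
Qed.

End Convolution.
End NestedCommutators.

(** * Transfer to the species of linear orders *)

Section LeftBracketing.
Variables (k : fieldType) (U : finType).
Implicit Types (S T I : {set U}) (s t w : seq U).

Lemma extendE (A : finType) (V : vectType k) (f : A -> V)
    (x : {ffun A -> k^o}) : extend f x = \sum_a x a *: f a.
Proof. by rewrite lfunE. Qed.

Lemma L_sum_H I (x : L k I) :
  x = \sum_(l : linord I) (x : {ffun linord I -> k^o}) l *: H k I (val l).
Proof.
rewrite -extendE; apply/ffunP => l; rewrite extendE sum_ffunE.
rewrite (bigD1 l) //= big1 => [|m ml]; rewrite ffunE H_val ffunE.
  by rewrite eqxx addr0 /GRing.scale /= mulr1.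
by rewrite eq_sym (negPf ml) scaler0.
Qed.

Lemma mu_tens I S T s t :
    s \in permutations (enum S) -> t \in permutations (enum T) ->
  mu k I S T (tens (H k S s) (H k T t)) = H k I (s ++ t).
Proof. by move=> sS tT; rewrite (mu_H k I (SeqSub sS) (SeqSub tT)). Qed.

Lemma Delta_tens I S T s : s \in permutations (enum I) ->
  Delta k I S T (H k I s) = tens (H k S (restrict S s)) (H k T (restrict T s)).
Proof. by move=> sI; rewrite (Delta_H k S T (SeqSub sI)). Qed.

Lemma bracketBl I S T (y : L k T) :
  {morph (fun x : L k S => bracket I x y) : u v / u - v}.
Proof.
move=> u v; rewrite /bracket.
have -> : tens (u - v) y = tens u y - tens v y.
  by apply/ffunP => p; rewrite !ffunE mulrBl.
have -> : tens y (u - v) = tens y u - tens y v.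
  by apply/ffunP => p; rewrite !ffunE mulrBr.
by rewrite !linearB /= addrACA.
Qed.

Lemma lbracket_rev_nested s S : s \in permutations (enum S) ->
  lbracket_rev k s S = nested s (H k S).
Proof.
elim: s S => // i [|j t] IH S // sS.
have tS : j :: t \in permutations (enum (S :\ i)).
  move: sS; rewrite !mem_permutations_enum => /andP[/andP[it ut] /eqP <-].
  apply/andP; split=> //; apply/eqP/setP => m.
  rewrite in_setD1 !in_set [in RHS]in_cons.
  by case: eqVneq => // ->; rewrite (negPf it).
have iE : [:: i] \in permutations (enum [set i]).
  by rewrite mem_permutations_enum /=; apply/eqP/setP => m; rewrite !inE.
rewrite nestedS //.
rewrite -[LHS]/(bracket S (lbracket_rev k (j :: t) (S :\ i)) (H k _ [:: i])).
rewrite (IH _ tS) [LHS](morph_nested _ _ (@bracketBl S _ _ _)).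
apply: eq_nested => w wt /=.
have wS : w \in permutations (enum (S :\ i)).
  by rewrite mem_permutations (perm_trans wt) // -mem_permutations.
by rewrite /bracket !mu_tens.
Qed.

Lemma rev_linord I s :
  s \in permutations (enum I) -> rev s \in permutations (enum I).
Proof. by rewrite !mem_permutations perm_rev. Qed.

Lemma mem_linord I (l : linord I) : val l =i I.
Proof.
move=> i; have := valP l; rewrite mem_permutations => /perm_mem ->.
exact: mem_enum.
Qed.

Lemma left_bracketing_nested I (x : L k I) :
  left_bracketing k I x = \sum_(l : linord I)
    (x : {ffun linord I -> k^o}) l *: nested (rev (val l)) (H k I).
Proof.
rewrite extendE; apply: eq_bigr => l _.
by rewrite (lbracket_rev_nested (rev_linord (valP l))).
Qed.

Lemma memLP I (x : L k I) :
  reflect (forall S T, decomposition I S T -> S != set0 -> T != set0 ->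
             Delta k I S T x = 0) (x \in Lie k I).
Proof.
rewrite memvE /Lie.
apply: (iffP subv_bigcapP) => [xL S T dST S0 T0|xL [S T] /=].
  apply/eqP; rewrite -memv_ker memvE.
  by apply: (xL (S, T)); rewrite dST S0 T0.
by case/and3P=> dST S0 T0; rewrite -memvE memv_ker xL.
Qed.

(** By linearity [Delta] passes inside [nested], where its value on a word depends only on the two
    restrictions, as [nested_primitive] requires. *)
Lemma left_bracketing_Lie I (x : L k I) : left_bracketing k I x \in Lie k I.
Proof.
rewrite left_bracketing_nested; apply: memv_suml => l _; apply: memvZ.
apply/memLP => S T /andP[/eqP STI dST] S0 T0.
have lI := rev_linord (valP l); set s := rev _ in lI *.
have sI : [set:: s] = I.
  by move: lI; rewrite mem_permutations_enum => /andP[_ /eqP].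
have hs (R : {set U}) : R \subset I -> R != set0 -> has (mem R) s.
  move=> /subsetP RI /set0Pn[i iR]; apply/hasP; exists i => //.
  by have := RI i iR; rewrite -sI inE.
rewrite (morph_nested _ _ (raddfB _)).
rewrite -[RHS](@nested_primitive _ _ S T s
  (fun a b => tens (H k S a) (H k T b))) //.
- apply: eq_nested => w ws /=; rewrite Delta_tens // mem_permutations.
  by rewrite (perm_trans ws) // -mem_permutations.
- by move=> i; rewrite STI -sI inE.
- by apply: hs; rewrite // -STI subsetUl.
- by apply: hs; rewrite // -STI subsetUr.
Qed.

(** The antipode on the first factor followed by the product, with the sign left out. *)
Definition antipode_mu I S T : 'Hom(LL k T S, L k I) :=
  extend (fun p : linord T * linord S => H k I (rev (val p.1) ++ val p.2)).

Lemma antipode_mu_Delta I S (x : L k I) : S \subset I ->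
  antipode_mu I S (I :\: S) (Delta k I (I :\: S) S x) =
    \sum_(l : linord I) (x : {ffun linord I -> k^o}) l *:
      H k I (antipode_word S (rev (val l))).
Proof.
move=> SI; rewrite [Delta _ _ _ _ _]extendE linear_sum; apply: eq_bigr => l _.
rewrite linearZ /=; congr (_ *: _).
have lT := restrict_linord (subsetDl I S) (valP l).
have lS := restrict_linord SI (valP l).
rewrite -[restrict (I :\: S) _]/(val (SeqSub lT)).
rewrite -[restrict S _]/(val (SeqSub lS)) !H_val tens_delta.
rewrite /antipode_mu extend_delta /antipode_word /restrict !filter_rev revK /=.
congr (H _ _ (rev _ ++ _)); apply: eq_in_filter => i.
by rewrite mem_linord !inE => ->; rewrite andbT.
Qed.

(** Exchanging the sums over orders and subsets makes each term factor through [Delta], so that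
    primitivity of [x] can be used. *)
Lemma left_bracketing_conv I (x : L k I) : I != set0 ->
  left_bracketing k I x = \sum_(S : {set U} | S \subset I)
    (-1) ^+ #|I :\: S| *:
      (antipode_mu I S (I :\: S) (Delta k I (I :\: S) S x) *+ #|S|).
Proof.
move=> I0; rewrite left_bracketing_nested.
under [RHS]eq_bigr => S SI do
  rewrite antipode_mu_Delta // -sumrMnl scaler_sumr.
rewrite exchange_big; apply: eq_bigr => l _ /=.
have := rev_linord (valP l); rewrite mem_permutations_enum.
set s := rev _ => /andP[us /eqP sI].
rewrite -antipode_conv_degree //; last first.
  by apply: contraNneq I0 => s0; rewrite -sI s0 set_nil.
rewrite /antipode_conv sI scaler_sumr; apply: eq_bigr => S _.
by rewrite scalerMnr !scalerA mulrC.
Qed.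

Lemma left_bracketing_on_Lie I (x : L k I) : I != set0 -> x \in Lie k I ->
  left_bracketing k I x = #|I|%:R *: x.
Proof.
move=> I0 /memLP xL; rewrite left_bracketing_conv // (bigD1 I) //=.
rewrite big1 => [|S /andP[SI SneI]].
  rewrite addr0 antipode_mu_Delta // setDv cards0 scale1r scaler_nat.
  congr (_ *+ _); rewrite [RHS]L_sum_H; apply: eq_bigr => l _.
  congr (_ *: H _ _ _).
  have sI : {subset rev (val l) <= I} by move=> i; rewrite mem_rev mem_linord.
  rewrite /antipode_word (restrict_id sI) revK restrict_nil //.
  by apply/hasPn => i /sI; rewrite /= inE negbK.
(* Primitivity says nothing about empty [S]; there the degree factor is 0. *)
have [->|S0] := eqVneq S set0; first by rewrite cards0 mulr0n scaler0.
rewrite xL ?linear0 ?mul0rn ?scaler0 //.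
- rewrite /decomposition setUC setDE setUIr setUCr setIT.
  by rewrite (setUidPr SI) eqxx disjoints_subset subsetIr.
- by rewrite setD_eq0; apply: contra SneI => IS; rewrite eqEsubset SI.
Qed.

End LeftBracketing.

Theorem corollary114 (k : fieldType) (char0 : [pchar k] =i pred0)
    (U : finType) (I : {set U}) (I_nonempty : I != set0) :
  limg (left_bracketing k I) = Lie k I /\
  Lie k I = passmx.leigenspace (left_bracketing k I) #|I|%:R.
Proof.
have n0 : #|I|%:R != 0 :> k.
  by rewrite ((pcharf0P k).1 char0) cards_eq0.
have eigenP x : (x \in passmx.leigenspace (left_bracketing k I) #|I|%:R) =
    (left_bracketing k I x == #|I|%:R *: x).
  by rewrite memv_ker add_lfunE opp_lfunE scale_lfunE id_lfunE subr_eq0.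
split; apply/vspaceP => x.
  apply/idP/idP => [/memv_imgP[y _ ->]|xL]; first exact: left_bracketing_Lie.
  (* The operator scales elements of [Lie k I] by [#|I|], which is invertible by [n0]. *)
  apply/memv_imgP; exists (#|I|%:R^-1 *: x); first exact: memvf.
  by rewrite linearZ /= left_bracketing_on_Lie // scalerA mulVf // scale1r.
rewrite eigenP; apply/idP/eqP => [|xE]; first exact: left_bracketing_on_Lie.
(* An eigenvector is a multiple of its own image, hence lies in [Lie k I]. *)
by rewrite -[x](scalerK n0) -xE memvZ // left_bracketing_Lie.
Qed.
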